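(* Let $I=[a,b]$ and let $(\gamma,\nu):I\to\mathbb{R}^2\times S^1$ be a closed Legendre immersion with curvature $(\ell,\beta)$. If $\gamma$ is a simple closed convex front with at least two singular points and at least two inflection points, then $\gamma$ has at least four vertices.
   Context: All maps are $C^\infty$. $\mathbb{R}^2$ has the standard inner product, $S^1\subset\mathbb{R}^2$ is the unit circle, and $J(x,y)=(-y,x)$. A smooth map $(\gamma,\nu):I\to\mathbb{R}^2\times S^1$ is a Legendre curve if $\dot\gamma(t)\cdot\nu(t)=0$ for all $t\in I$; if moreover $(\gamma,\nu)$ is an immersion it is a Legendre immersion and $\gamma$ is called a front. Put $\mu=J(\nu)$. The curvature $(\ell,\beta)$ is $\ell=\dot\nu\cdot\mu$, $\beta=\dot\gamma\cdot\mu$, so that $\dot\nu=\ell\mu$, $\dot\mu=-\ell\nu$, $\dot\gamma=\beta\mu$; $(\gamma,\nu)$ is a Legendre immersion iff $(\ell(t),\beta(t))\ne(0,0)$ for all $t$. A singular point is a point $t_0$ with $\dot\gamma(t_0)=0$ (i.e. $\beta(t_0)=0$); an inflection point is a point $t_0$ with $\ell(t_0)=0$. A Legendre curve on $[a,b]$ is closed if it is at least $C^1$-closed: $(\gamma^{(k)}(a),\nu^{(k)}(a))=(\gamma^{(k)}(b),\nu^{(k)}(b))$ for $k=0,1$ (one-sided derivatives). When $a$ and $b$ are singular points of $\gamma$, they are treated as one singular point. $\gamma$ is simple closed if for $t_1<t_2$ one has $\gamma(t_1)=\gamma(t_2)$ if and only if $t_1=a$ and $t_2=b$. $\gamma$ is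 convex if either $(\gamma(s)-\gamma(t))\cdot\nu(t)\ge 0$ for all $s,t\in I$, or $(\gamma(s)-\gamma(t))\cdot\nu(t)\le 0$ for all $s,t\in I$. Vertices (general case): if there is a smooth map $(k_1,k_2):I\to\mathbb{R}^2\setminus\{0\}$ with $k_1\ell+k_2\beta=0$ on $I$, then $t_0\in I$ is a vertex of $\gamma$ if $\dot k_1(t_0)k_2(t_0)-k_1(t_0)\dot k_2(t_0)=0$. For a Legendre immersion such a pair always exists, e.g. $(k_1,k_2)=(-\beta,\ell)$, and is unique up to multiplication by a nowhere vanishing smooth function, so being a vertex does not depend on the choice.
   Formalization: Added, since the claim fails for merely C^1-closed curves: if the base point a is a singular point then γ''(a)=γ''(b), and if it is an inflection point then ν''(a)=ν''(b) (automatic for C^2-closed curves). *)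

(* Defs.v *)
From Stdlib Require Export Reals.
From Stdlib Require Import ClassicalEpsilon.
Open Scope R_scope.

Definition R2 : Type := (R * R)%type.

Definition vsub (v w : R2) : R2 := (fst v - fst w, snd v - snd w).

Definition dot (v w : R2) : R := fst v * fst w + snd v * snd w.

Definition J (v : R2) : R2 := (- snd v, fst v).

Definition on_circle (v : R2) : Prop := dot v v = 1.

Definition Icc (a b : R) (t : R) : Prop := a <= t <= b.

(* Maps on [a,b] are encoded as functions on R; all notions below only involve
   their values on [a,b].  [D_in] takes the limit of the difference quotient
   inside [a,b], hence the one-sided derivative at a and at b. *)
Definition derivable_on_at (a b : R) (f : R -> R) (t : R) : Prop :=
  exists l : R, D_in f (fun _ => l) (Icc a b) t.

(* Arbitrary value where the derivative does not exist. *)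
Definition deriv (a b : R) (f : R -> R) (t : R) : R :=
  epsilon (inhabits 0) (fun l => D_in f (fun _ => l) (Icc a b) t).

Definition deriv_n (a b : R) (n : nat) (f : R -> R) : R -> R :=
  Nat.iter n (deriv a b) f.

Definition smooth (a b : R) (f : R -> R) : Prop :=
  forall (n : nat) (t : R), Icc a b t -> derivable_on_at a b (deriv_n a b n f) t.

Definition smooth2 (a b : R) (g : R -> R2) : Prop :=
  smooth a b (fun t => fst (g t)) /\ smooth a b (fun t => snd (g t)).

Definition vderiv_n (a b : R) (n : nat) (g : R -> R2) (t : R) : R2 :=
  (deriv_n a b n (fun s => fst (g s)) t, deriv_n a b n (fun s => snd (g s)) t).

Definition vderiv (a b : R) (g : R -> R2) : R -> R2 := vderiv_n a b 1 g.

Definition legendre_curve (a b : R) (gamma nu : R -> R2) : Prop :=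
  smooth2 a b gamma /\ smooth2 a b nu /\
  (forall t, Icc a b t -> on_circle (nu t)) /\
  (forall t, Icc a b t -> dot (vderiv a b gamma t) (nu t) = 0).

Definition legendre_immersion (a b : R) (gamma nu : R -> R2) : Prop :=
  legendre_curve a b gamma nu /\
  (forall t, Icc a b t ->
     ~ (vderiv a b gamma t = (0, 0) /\ vderiv a b nu t = (0, 0))).

Definition mu (nu : R -> R2) (t : R) : R2 := J (nu t).

Definition ell (a b : R) (nu : R -> R2) (t : R) : R :=
  dot (vderiv a b nu t) (mu nu t).

Definition beta (a b : R) (gamma nu : R -> R2) (t : R) : R :=
  dot (vderiv a b gamma t) (mu nu t).

Definition singular_point (a b : R) (gamma : R -> R2) (t : R) : Prop :=
  vderiv a b gamma t = (0, 0).

Definition inflection_point (a b : R) (nu : R -> R2) (t : R) : Prop :=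
  ell a b nu t = 0.

Definition C1_closed (a b : R) (gamma nu : R -> R2) : Prop :=
  forall k : nat, (k <= 1)%nat ->
    vderiv_n a b k gamma a = vderiv_n a b k gamma b /\
    vderiv_n a b k nu a = vderiv_n a b k nu b.

(* A restriction on the base point only, void unless it is a singular point or
   an inflection point.  C^1-closedness alone allows (beta,ell) to have a corner
   where a and b are glued: the curve y = |x|^(3/2), with beta = |t|, has a
   singular point there which is not a vertex from either side, and there are
   C^1-closed simple convex fronts with such a base point, two singular points
   and two inflection points, but only three vertices. *)
Definition no_corner_at_base_point (a b : R) (gamma nu : R -> R2) : Prop :=
  (singular_point a b gamma a ->
     vderiv_n a b 2 gamma a = vderiv_n a b 2 gamma b) /\
  (inflection_point a b nu a ->
     vderiv_n a b 2 nu a = vderiv_n a b 2 nu b).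

Definition simple_closed (a b : R) (gamma : R -> R2) : Prop :=
  forall t1 t2, Icc a b t1 -> Icc a b t2 -> t1 < t2 ->
    (gamma t1 = gamma t2 <-> t1 = a /\ t2 = b).

Definition convex (a b : R) (gamma nu : R -> R2) : Prop :=
  (forall s t, Icc a b s -> Icc a b t ->
     dot (vsub (gamma s) (gamma t)) (nu t) >= 0) \/
  (forall s t, Icc a b s -> Icc a b t ->
     dot (vsub (gamma s) (gamma t)) (nu t) <= 0).

Definition vertex (a b : R) (gamma nu : R -> R2) (t0 : R) : Prop :=
  exists k1 k2 : R -> R,
    smooth a b k1 /\ smooth a b k2 /\
    (forall t, Icc a b t -> (k1 t, k2 t) <> (0, 0)) /\
    (forall t, Icc a b t ->
       k1 t * ell a b nu t + k2 t * beta a b gamma nu t = 0) /\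
    deriv a b k1 t0 * k2 t0 - k1 t0 * deriv a b k2 t0 = 0.

(* Equality of points of the closed curve: a and b are one point. *)
Definition same_point (a b s t : R) : Prop :=
  s = t \/ (s = a /\ t = b) \/ (s = b /\ t = a).

Definition at_least (n : nat) (a b : R) (P : R -> Prop) : Prop :=
  exists p : nat -> R,
    (forall i, (i < n)%nat -> Icc a b (p i) /\ P (p i)) /\
    (forall i j, (i < j)%nat -> (j < n)%nat -> ~ same_point a b (p i) (p j)).

(* Main.v *)
(* Write g(s) = (gamma(s) - gamma(t)) . nu(t), and suppose that t is singular or
   an inflection point, i.e. gamma'(t) . nu'(t) = 0.  Differentiating gamma' . nu = 0
   twice gives g = g' = g'' = 0 at t and g''' = -(2 gamma'' . nu' + gamma' . nu'').
   Convexity says that g has constant sign, so g'''(t) = 0; at the base point one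
   gets opposite inequalities at the two ends, and they concern the same number
   because there is no corner.  At a singular point this number is
   -2 beta' ell, at an inflection point it is -beta ell', so in both cases
   beta' ell - beta ell' = 0: singular points and inflection points are all
   vertices, and they are distinct because (gamma, nu) is an immersion. *)

Require Import Defs.
From Stdlib Require Import Reals Lra Psatz ClassicalEpsilon Arith.
Open Scope R_scope.

(** * Derivatives relative to [a,b] *)

(** [D_in] reads its second function only at t, so a constant function can carry the derivative.
    Working with this relation avoids [epsilon]. *)
Definition deriv_at (a b : R) (f : R -> R) (t l : R) : Prop :=
  D_in f (fun _ => l) (Icc a b) t.

Lemma deriv_at_iff (a b : R) (f : R -> R) (t l : R) :
  deriv_at a b f t l <->
  (forall eps, 0 < eps -> exists delta, 0 < delta /\
     forall s, Icc a b s -> s <> t -> Rabs (s - t) < delta ->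
       Rabs ((f s - f t) / (s - t) - l) < eps).
Proof.
  split; intros H eps Heps; destruct (H eps Heps) as [d [Hd H']];
    exists d; split; trivial.
  - intros s Hs Hst Hsd. apply (H' s). split; [split; auto |]; exact Hsd.
  - intros s [[Hs Hst] Hsd]. exact (H' s Hs (not_eq_sym Hst) Hsd).
Qed.

Lemma deriv_at_const (a b c t : R) : deriv_at a b (fun _ => c) t 0.
Proof. exact (Dconst (Icc a b) c t). Qed.

Lemma deriv_at_plus (a b : R) (f g : R -> R) (t l m : R) :
  deriv_at a b f t l -> deriv_at a b g t m ->
  deriv_at a b (fun s => f s + g s) t (l + m).
Proof. exact (Dadd (Icc a b) (fun _ => l) (fun _ => m) f g t). Qed.

Lemma deriv_at_opp (a b : R) (f : R -> R) (t l : R) :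
  deriv_at a b f t l -> deriv_at a b (fun s => - f s) t (- l).
Proof. exact (Dopp (Icc a b) f (fun _ => l) t). Qed.

Lemma deriv_at_mult (a b : R) (f g : R -> R) (t l m : R) :
  deriv_at a b f t l -> deriv_at a b g t m ->
  deriv_at a b (fun s => f s * g s) t (l * g t + f t * m).
Proof. exact (Dmult (Icc a b) (fun _ => l) (fun _ => m) f g t). Qed.

Lemma deriv_at_ext (a b : R) (f g : R -> R) (t l : R) :
  Icc a b t -> (forall s, Icc a b s -> f s = g s) ->
  deriv_at a b f t l -> deriv_at a b g t l.
Proof.
  intros Ht E H. apply deriv_at_iff. intros eps Heps.
  destruct (proj1 (deriv_at_iff a b f t l) H eps Heps) as [d [Hd H']].
  exists d; split; trivial. intros s Hs. rewrite <- !E by trivial. now apply H'.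
Qed.

(** This is where a < b enters the uniqueness of derivatives: t must be a limit of other points of
    [a,b]. Left of b one can step right, at b one steps left. *)
Lemma Icc_adherent (a b t : R) :
  a < b -> Icc a b t -> adhDa (D_x (Icc a b) t) t.
Proof.
  intros hab [H1 H2] eps Heps. unfold D_x, Icc, Rdist.
  destruct (Rlt_dec t b) as [Hb | Hb].
  - exists (t + Rmin (b - t) (eps / 2)).
    assert (0 < Rmin (b - t) (eps / 2)) by (apply Rmin_glb_lt; lra).
    pose proof (Rmin_l (b - t) (eps / 2)). pose proof (Rmin_r (b - t) (eps / 2)).
    split; [lra |]. apply Rabs_def1; lra.
  - exists (t - Rmin (t - a) (eps / 2)).
    assert (0 < Rmin (t - a) (eps / 2)) by (apply Rmin_glb_lt; lra).
    pose proof (Rmin_l (t - a) (eps / 2)). pose proof (Rmin_r (t - a) (eps / 2)).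
    split; [lra |]. apply Rabs_def1; lra.
Qed.

Lemma deriv_at_unique (a b : R) (f : R -> R) (t l m : R) :
  a < b -> Icc a b t -> deriv_at a b f t l -> deriv_at a b f t m -> l = m.
Proof.
  intros hab Ht Hl Hm.
  exact (single_limit _ _ _ _ _ (Icc_adherent a b t hab Ht) Hl Hm).
Qed.

Lemma deriv_eq (a b : R) (f : R -> R) (t l : R) :
  a < b -> Icc a b t -> deriv_at a b f t l -> deriv a b f t = l.
Proof.
  intros hab Ht Hl. apply (deriv_at_unique a b f t); trivial.
  apply (epsilon_spec (inhabits 0) (fun l => deriv_at a b f t l)). now exists l.
Qed.

Lemma derivable_deriv_at (a b : R) (f : R -> R) (t : R) :
  derivable_on_at a b f t -> deriv_at a b f t (deriv a b f t).
Proof. exact (epsilon_spec (inhabits 0) (fun l => deriv_at a b f t l)). Qed.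

(** * Smoothness and its closure properties *)

(** Here f' may be any function that is a derivative of f on [a,b], so sums and products get
    explicit formulas, and values outside [a,b] do not matter. *)
Fixpoint differentiable_n (a b : R) (n : nat) (f : R -> R) : Prop :=
  match n with
  | O => True
  | S n => exists f', (forall t, Icc a b t -> deriv_at a b f t (f' t)) /\
                      differentiable_n a b n f'
  end.

Lemma differentiable_n_S (a b : R) (n : nat) (f : R -> R) :
  differentiable_n a b (S n) f -> differentiable_n a b n f.
Proof.
  revert f; induction n as [|n IH]; intros f; [easy |].
  intros [f' [H Hf']]. exists f'; split; trivial. now apply IH.
Qed.

Lemma differentiable_n_ext (a b : R) (n : nat) (f g : R -> R) :
  (forall t, Icc a b t -> f t = g t) ->
  differentiable_n a b n f -> differentiable_n a b n g.
Proof.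
  destruct n as [|n]; [easy |]. intros E [f' [H Hf']].
  exists f'; split; trivial. intros t Ht. apply (deriv_at_ext a b f); auto.
Qed.

Lemma differentiable_n_plus (a b : R) (n : nat) (f g : R -> R) :
  differentiable_n a b n f -> differentiable_n a b n g ->
  differentiable_n a b n (fun t => f t + g t).
Proof.
  revert f g; induction n as [|n IH]; intros f g; [easy |].
  intros [f' [Hf Hf']] [g' [Hg Hg']].
  exists (fun t => f' t + g' t); split; [| now apply IH].
  intros t Ht. apply deriv_at_plus; auto.
Qed.

Lemma differentiable_n_opp (a b : R) (n : nat) (f : R -> R) :
  differentiable_n a b n f -> differentiable_n a b n (fun t => - f t).
Proof.
  revert f; induction n as [|n IH]; intros f; [easy |].
  intros [f' [Hf Hf']].
  exists (fun t => - f' t); split; [| now apply IH].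
  intros t Ht. apply deriv_at_opp; auto.
Qed.

Lemma differentiable_n_mult (a b : R) (n : nat) (f g : R -> R) :
  differentiable_n a b n f -> differentiable_n a b n g ->
  differentiable_n a b n (fun t => f t * g t).
Proof.
  revert f g; induction n as [|n IH]; intros f g; [easy |].
  intros Hf Hg.
  assert (Hf0 := differentiable_n_S a b n f Hf).
  assert (Hg0 := differentiable_n_S a b n g Hg).
  destruct Hf as [f' [Hf Hf']], Hg as [g' [Hg Hg']].
  exists (fun t => f' t * g t + f t * g' t); split.
  - intros t Ht. apply deriv_at_mult; auto.
  - apply differentiable_n_plus; now apply IH.
Qed.

(** Each direction is an induction whose statement covers all iterates, or all orders, at once. The
    converse uses uniqueness of derivatives to identify [deriv] with f' on [a,b]. *)
Lemma smooth_iff_differentiable_n (a b : R) (f : R -> R) :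
  a < b -> smooth a b f <-> (forall n, differentiable_n a b n f).
Proof.
  intros hab; split.
  - intros H n.
    enough (Hm : forall m, differentiable_n a b n (deriv_n a b m f)) by exact (Hm O).
    induction n as [|n IH]; intros m; [easy |].
    exists (deriv_n a b (S m) f); split; [| apply IH].
    intros t Ht. apply derivable_deriv_at. now apply H.
  - intros H m.
    enough (Hm : forall n, differentiable_n a b n (deriv_n a b m f)).
    { intros t Ht. destruct (Hm 1%nat) as [f' [Hf' _]].
      exists (f' t). now apply Hf'. }
    induction m as [|m IH]; [exact H |].
    intros n. destruct (IH (S n)) as [f' [Hf Hf']].
    apply (differentiable_n_ext a b n f'); trivial.
    intros t Ht. symmetry. apply deriv_eq; auto.
Qed.

Lemma smooth_plus (a b : R) (f g : R -> R) :
  a < b -> smooth a b f -> smooth a b g -> smooth a b (fun t => f t + g t).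
Proof.
  intros hab Hf Hg. apply smooth_iff_differentiable_n; trivial.
  intros n. apply differentiable_n_plus; now apply smooth_iff_differentiable_n.
Qed.

Lemma smooth_opp (a b : R) (f : R -> R) :
  a < b -> smooth a b f -> smooth a b (fun t => - f t).
Proof.
  intros hab Hf. apply smooth_iff_differentiable_n; trivial.
  intros n. apply differentiable_n_opp; now apply smooth_iff_differentiable_n.
Qed.

Lemma smooth_mult (a b : R) (f g : R -> R) :
  a < b -> smooth a b f -> smooth a b g -> smooth a b (fun t => f t * g t).
Proof.
  intros hab Hf Hg. apply smooth_iff_differentiable_n; trivial.
  intros n. apply differentiable_n_mult; now apply smooth_iff_differentiable_n.
Qed.

Lemma smooth_deriv (a b : R) (f : R -> R) : smooth a b f -> smooth a b (deriv a b f).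
Proof.
  intros H n t Ht. unfold deriv_n. rewrite <- Nat.iter_succ_r. exact (H (S n) t Ht).
Qed.

Lemma smooth_deriv_at (a b : R) (f : R -> R) (t : R) :
  smooth a b f -> Icc a b t -> deriv_at a b f t (deriv a b f t).
Proof. intros H Ht. apply derivable_deriv_at. exact (H O t Ht). Qed.

(** * The mean value theorem and signs near a zero *)

(* The standard mean value theorem asks for two-sided continuity at the ends of
   [x,y], so it is applied to f composed with the retraction of R onto [x,y]. *)
Lemma deriv_at_MVT_lt (a b : R) (f f' : R -> R) (x y : R) :
  (forall t, Icc a b t -> deriv_at a b f t (f' t)) ->
  Icc a b x -> Icc a b y -> x < y ->
  exists c, x < c < y /\ f y - f x = f' c * (y - x).
Proof.
  intros Hf [Hx1 Hx2] [Hy1 Hy2] Hxy.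
  set (p := fun t => Rmax x (Rmin t y)).
  assert (Hp : forall t, Icc x y t -> p t = t).
  { intros t [H1 H2]. unfold p. rewrite Rmin_left, Rmax_right; lra. }
  assert (Hp_in : forall t, Icc x y (p t)).
  { intros t. unfold p, Icc, Rmax, Rmin.
    destruct (Rle_dec t y); destruct (Rle_dec x _); lra. }
  assert (Hp_lip : forall s t, Rabs (p s - p t) <= Rabs (s - t)).
  { intros s t. unfold p, Rmax, Rmin, Rabs.
    destruct (Rle_dec s y), (Rle_dec t y); repeat destruct (Rle_dec x _);
      repeat destruct (Rcase_abs _); lra. }
  set (F := fun t => f (p t)).
  assert (HD : forall c, x < c < y -> derivable_pt_lim F c (f' c)).
  { intros c Hc eps Heps.
    destruct (proj1 (deriv_at_iff a b f c (f' c)) ltac:(apply Hf; unfold Icc; lra)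
                eps Heps) as [d [Hd H]].
    assert (Hm : 0 < Rmin d (Rmin (c - x) (y - c)))
      by (repeat apply Rmin_glb_lt; lra).
    exists (mkposreal _ Hm). simpl. intros h Hh0 Hh.
    pose proof (Rmin_l d (Rmin (c - x) (y - c))).
    pose proof (Rmin_r d (Rmin (c - x) (y - c))).
    pose proof (Rmin_l (c - x) (y - c)). pose proof (Rmin_r (c - x) (y - c)).
    assert (Hh' : Rabs h < Rmin (c - x) (y - c)) by lra.
    apply Rabs_def2 in Hh'.
    unfold F. rewrite !Hp by (unfold Icc; lra).
    specialize (H (c + h)). replace (c + h - c) with h in H by ring.
    apply H; unfold Icc; lra. }
  assert (HC : forall c, x <= c <= y -> continuity_pt F c).
  { intros c Hc eps Heps.
    assert (Hc' : Icc a b c) by (unfold Icc; lra).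
    destruct (cont_deriv _ _ _ _ (Hf c Hc') eps Heps) as [d [Hd H]].
    exists d; split; trivial. intros s [_ Hs].
    unfold F. rewrite (Hp c) by exact Hc.
    (* The limit in [D_in] leaves out the centre c, but the retraction may send s to it; then the
       difference is 0. *)
    destruct (Req_dec (p s) c) as [E | E].
    - rewrite E. cbn. unfold Rdist. rewrite Rminus_diag, Rabs_R0. exact Heps.
    - apply (H (p s)). split.
      + split; [destruct (Hp_in s); unfold Icc; lra | auto].
      + cbn in *. unfold Rdist in *. rewrite <- (Hp c) by exact Hc.
        apply Rle_lt_trans with (2 := Hs). apply Hp_lip. }
  destruct (MVT F id x y
              (fun c Hc => exist _ (f' c) (HD c Hc))
              (fun c _ => derivable_pt_id c) Hxy HC
              (fun c _ => derivable_continuous_pt _ _ (derivable_pt_id c)))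
    as [c [Hc E]].
  exists c; split; trivial.
  rewrite derive_pt_id in E. simpl in E. unfold id, F in E.
  rewrite !Hp in E by (unfold Icc; lra). lra.
Qed.

(** The ratio [th] places c between x and y whichever of them is larger, so later sign arguments
    need no case split. *)
Lemma deriv_at_MVT (a b : R) (f f' : R -> R) (x y : R) :
  (forall t, Icc a b t -> deriv_at a b f t (f' t)) ->
  Icc a b x -> Icc a b y -> x <> y ->
  exists c th, 0 < th < 1 /\ c = x + th * (y - x) /\ f y - f x = f' c * (y - x).
Proof.
  intros Hf Hx Hy Hxy.
  enough (exists c, 0 < (c - x) / (y - x) < 1 /\ f y - f x = f' c * (y - x))
    as [c [Hc E]].
  { exists c, ((c - x) / (y - x)). repeat split; try apply Hc; trivial. field; lra. }
  assert (Hlt : forall u v, 0 < v -> 0 < u < v -> 0 < u / v < 1).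
  { intros u v Hv Hu. split; [apply Rdiv_lt_0_compat; lra |].
    apply Rmult_lt_reg_r with v; trivial. field_simplify; lra. }
  destruct (Rlt_dec x y) as [L | L].
  - destruct (deriv_at_MVT_lt a b f f' x y) as [c [Hc E]]; trivial.
    exists c; split; trivial. apply Hlt; lra.
  - destruct (deriv_at_MVT_lt a b f f' y x) as [c [Hc E]]; trivial; [lra |].
    exists c; split; [| lra].
    replace ((c - x) / (y - x)) with ((x - c) / (x - y)) by (field; lra).
    apply Hlt; lra.
Qed.

(* The points of [a,b] on the same side of t as u, at distance less than d. *)
Definition side_nbhd (a b t u d s : R) : Prop :=
  Icc a b s /\ 0 < (s - t) * (u - t) /\ Rabs (s - t) < d.

Lemma side_nbhd_inhabited (a b t u d : R) :
  Icc a b t -> Icc a b u -> u <> t -> 0 < d -> exists s, side_nbhd a b t u d s.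
Proof.
  intros Ht Hu Hut Hd. unfold side_nbhd, Icc in *.
  pose proof (Rmin_l (Rabs (u - t)) (d / 2)).
  pose proof (Rmin_r (Rabs (u - t)) (d / 2)).
  assert (0 < Rmin (Rabs (u - t)) (d / 2)).
  { apply Rmin_glb_lt; [apply Rabs_pos_lt |]; lra. }
  set (r := Rmin (Rabs (u - t)) (d / 2)) in *.
  destruct (Rlt_dec t u).
  - rewrite Rabs_right in * by lra. exists (t + r).
    repeat split; try lra; [nra | apply Rabs_def1; lra].
  - rewrite Rabs_left in * by lra. exists (t - r).
    repeat split; try lra; [nra | apply Rabs_def1; lra].
Qed.

(** Once the difference quotient is within |l| of l it has the sign of l, so f s has the sign of l
    (s - t), which on the side of u is that of l (u - t). *)
Lemma deriv_sign_near_zero (a b : R) (f : R -> R) (t u l : R) :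
  deriv_at a b f t l -> f t = 0 -> l * (u - t) < 0 ->
  exists d, 0 < d /\ forall s, side_nbhd a b t u d s -> f s < 0.
Proof.
  intros Hf Hft Hl.
  assert (l <> 0) by nra.
  destruct (proj1 (deriv_at_iff a b f t l) Hf (Rabs l) (Rabs_pos_lt l H))
    as [d [Hd H']].
  exists d; split; trivial. intros s [Hs [Hsu Hsd]].
  assert (Hst : s <> t) by (intros ->; lra).
  specialize (H' s Hs Hst Hsd). rewrite Hft in H'.
  set (q := (f s - 0) / (s - t)) in *.
  assert (E : f s = q * (s - t)) by (unfold q; field; lra).
  assert (Hq : 0 < q * l).
  { revert H'. unfold Rabs. destruct (Rcase_abs l), (Rcase_abs (q - l)); nra. }
  assert (l * (s - t) < 0).
  { assert (Hp : (l * (s - t)) * ((u - t) * (u - t)) < 0).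
    { replace (l * (s - t) * ((u - t) * (u - t)))
        with ((l * (u - t)) * ((s - t) * (u - t))) by ring. nra. }
    pose proof (Rle_0_sqr (u - t)) as Hsq. unfold Rsqr in Hsq. nra. }
  rewrite E. nra.
Qed.

(** By the mean value theorem f s = f'(c) (s - t), with c in the same one-sided neighbourhood. The
    conclusion has the form of the assumption, with m replaced by m (u - t), so the lemma can be
    iterated. *)
Lemma deriv_sign_side (a b : R) (f f' : R -> R) (t u d m : R) :
  (forall s, Icc a b s -> deriv_at a b f s (f' s)) -> Icc a b t -> f t = 0 ->
  (forall s, side_nbhd a b t u d s -> 0 < m * f' s) ->
  forall s, side_nbhd a b t u d s -> 0 < m * (u - t) * f s.
Proof.
  intros Hf Ht Hft H s [Hs [Hsu Hsd]].
  assert (Hst : t <> s) by (intros ->; lra).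
  destruct (deriv_at_MVT a b f f' t s) as [c [th [Hth [Ec E]]]]; trivial.
  assert (Hc : side_nbhd a b t u d c).
  { unfold side_nbhd, Icc in *. repeat split.
    - nra.
    - nra.
    - replace (c - t) with (th * (s - t)) by lra. nra.
    - replace (c - t) with (th * (s - t)) by lra.
      rewrite Rabs_mult, (Rabs_right th) by lra.
      pose proof (Rabs_pos (s - t)). nra. }
  specialize (H c Hc).
  replace (f s) with (f' c * (s - t)) by lra.
  replace (m * (u - t) * (f' c * (s - t)))
    with ((m * f' c) * ((s - t) * (u - t))) by ring. nra.
Qed.

(** Otherwise g2 < 0 on the side of u near t. Two passages from derivative to function multiply the
    sign by (u - t) twice, that is by a positive square, so g < 0 there as well. *)
Lemma nonneg_third_deriv (a b : R) (g g1 g2 : R -> R) (t u l : R) :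
  (forall s, Icc a b s -> deriv_at a b g s (g1 s)) ->
  (forall s, Icc a b s -> deriv_at a b g1 s (g2 s)) ->
  deriv_at a b g2 t l ->
  g t = 0 -> g1 t = 0 -> g2 t = 0 ->
  (forall s, Icc a b s -> 0 <= g s) ->
  Icc a b t -> Icc a b u -> u <> t ->
  0 <= l * (u - t).
Proof.
  intros Hg Hg1 Hg2 E0 E1 E2 Hpos Ht Hu Hut.
  apply Rnot_lt_le; intros Hl.
  destruct (deriv_sign_near_zero a b g2 t u l) as [d [Hd H2]]; trivial.
  assert (H2' : forall s, side_nbhd a b t u d s -> 0 < -1 * g2 s).
  { intros s Hs. specialize (H2 s Hs). lra. }
  pose proof (deriv_sign_side a b g1 g2 t u d _ Hg1 Ht E1 H2') as H1.
  pose proof (deriv_sign_side a b g g1 t u d _ Hg Ht E0 H1) as H0.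
  destruct (side_nbhd_inhabited a b t u d) as [s Hs]; trivial.
  specialize (H0 s Hs). specialize (Hpos s (proj1 Hs)).
  pose proof (Rle_0_sqr (u - t)) as Hsq. unfold Rsqr in Hsq. nra.
Qed.

(** * Differential identities of a Legendre curve *)

(** In the orthonormal basis (p,q), (-q,p) only the second component of (u,v) survives. Applied with
    (p,q) = nu, it gives gamma' = beta mu and nu' = ell mu. *)
Lemma orthogonal_unit_coordinates (u v p q : R) :
  p * p + q * q = 1 -> u * p + v * q = 0 ->
  (u * - q + v * p) * - q = u /\ (u * - q + v * p) * p = v.
Proof.
  intros U V. split.
  - transitivity (u * (p * p + q * q) - (u * p + v * q) * p); [ring |].
    rewrite U, V. ring.
  - transitivity (v * (p * p + q * q) - (u * p + v * q) * q); [ring |].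
    rewrite U, V. ring.
Qed.

Section Legendre.

Variables (a b : R) (gamma nu : R -> R2).
Hypothesis hab : a < b.
Hypothesis hleg : legendre_curve a b gamma nu.

Let x t := fst (gamma t).
Let y t := snd (gamma t).
Let p t := fst (nu t).
Let q t := snd (nu t).
Let D := deriv a b.

Lemma legendre_smooth_coordinates :
  smooth a b x /\ smooth a b y /\ smooth a b p /\ smooth a b q.
Proof. destruct hleg as [[? ?] [[? ?] _]]. repeat split; assumption. Qed.

Lemma legendre_deriv_at (f : R -> R) (t : R) :
  f = x \/ f = y \/ f = p \/ f = q -> Icc a b t ->
  deriv_at a b f t (D f t) /\ deriv_at a b (D f) t (D (D f) t) /\
  deriv_at a b (D (D f)) t (D (D (D f)) t).
Proof.
  intros Hf Ht.
  assert (Hs : smooth a b f).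
  { destruct legendre_smooth_coordinates as (? & ? & ? & ?).
    destruct Hf as [-> | [-> | [-> | ->]]]; assumption. }
  unfold D. repeat split; apply smooth_deriv_at; trivial; repeat apply smooth_deriv; trivial.
Qed.

Lemma legendre_tangency (t : R) : Icc a b t -> D x t * p t + D y t * q t = 0.
Proof. destruct hleg as (_ & _ & _ & H). exact (H t). Qed.

Lemma legendre_unit (t : R) : Icc a b t -> p t * p t + q t * q t = 1.
Proof. destruct hleg as (_ & _ & H & _). exact (H t). Qed.

Lemma deriv_at_of_const (f : R -> R) (c t l : R) :
  Icc a b t -> (forall s, Icc a b s -> f s = c) -> deriv_at a b f t l -> l = 0.
Proof.
  intros Ht E H. apply (deriv_at_unique a b f t); trivial.
  apply (deriv_at_ext a b (fun _ => c)); trivial.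
  - intros s Hs. now rewrite E.
  - apply deriv_at_const.
Qed.

Lemma legendre_unit_deriv (t : R) : Icc a b t -> D p t * p t + D q t * q t = 0.
Proof.
  intros Ht.
  destruct (legendre_deriv_at p t ltac:(tauto) Ht) as [Hp _].
  destruct (legendre_deriv_at q t ltac:(tauto) Ht) as [Hq _].
  pose proof (deriv_at_of_const _ 1 t _ Ht legendre_unit
    (deriv_at_plus _ _ _ _ _ _ _
       (deriv_at_mult _ _ _ _ _ _ _ Hp Hp) (deriv_at_mult _ _ _ _ _ _ _ Hq Hq))).
  lra.
Qed.

Lemma legendre_tangency_deriv (t : R) :
  Icc a b t ->
  D (D x) t * p t + D (D y) t * q t + (D x t * D p t + D y t * D q t) = 0.
Proof.
  intros Ht.
  destruct (legendre_deriv_at x t ltac:(tauto) Ht) as (_ & Hx & _).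
  destruct (legendre_deriv_at y t ltac:(tauto) Ht) as (_ & Hy & _).
  destruct (legendre_deriv_at p t ltac:(tauto) Ht) as [Hp _].
  destruct (legendre_deriv_at q t ltac:(tauto) Ht) as [Hq _].
  pose proof (deriv_at_of_const _ 0 t _ Ht legendre_tangency
    (deriv_at_plus _ _ _ _ _ _ _
       (deriv_at_mult _ _ _ _ _ _ _ Hx Hp) (deriv_at_mult _ _ _ _ _ _ _ Hy Hq))).
  lra.
Qed.

(** Obtained by differentiating gamma' . nu = 0 twice. The left-hand side gamma''' . nu is isolated
    because it is the third derivative at t of s -> (gamma(s) - gamma(t)) . nu(t). *)
Lemma legendre_tangency_deriv2 (t : R) :
  Icc a b t ->
  D (D (D x)) t * p t + D (D (D y)) t * q t =
  - (2 * (D (D x) t * D p t + D (D y) t * D q t)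
     + (D x t * D (D p) t + D y t * D (D q) t)).
Proof.
  intros Ht.
  destruct (legendre_deriv_at x t ltac:(tauto) Ht) as (_ & Hx & Hx2).
  destruct (legendre_deriv_at y t ltac:(tauto) Ht) as (_ & Hy & Hy2).
  destruct (legendre_deriv_at p t ltac:(tauto) Ht) as (Hp & Hp1 & _).
  destruct (legendre_deriv_at q t ltac:(tauto) Ht) as (Hq & Hq1 & _).
  pose proof (deriv_at_of_const _ 0 t _ Ht legendre_tangency_deriv
    (deriv_at_plus _ _ _ _ _ _ _
      (deriv_at_plus _ _ _ _ _ _ _
        (deriv_at_mult _ _ _ _ _ _ _ Hx2 Hp) (deriv_at_mult _ _ _ _ _ _ _ Hy2 Hq))
      (deriv_at_plus _ _ _ _ _ _ _
        (deriv_at_mult _ _ _ _ _ _ _ Hx Hp1) (deriv_at_mult _ _ _ _ _ _ _ Hy Hq1)))).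
  lra.
Qed.

(** This is -gamma''' . nu written with derivatives of order at most two, which makes its values at
    a and b comparable. *)
Definition third_contact (t : R) : R :=
  2 * (D (D x) t * D p t + D (D y) t * D q t)
  + (D x t * D (D p) t + D y t * D (D q) t).

Definition singular_or_inflection (t : R) : Prop :=
  singular_point a b gamma t \/ inflection_point a b nu t.

Lemma singular_iff (t : R) :
  singular_point a b gamma t <-> D x t = 0 /\ D y t = 0.
Proof.
  unfold singular_point. split.
  - intros E. injection E. now split.
  - intros [Ex Ey]. exact (f_equal2 pair Ex Ey).
Qed.

(** Since nu is a unit vector, nu' is orthogonal to it, hence nu' = ell mu. *)
Lemma inflection_iff (t : R) :
  Icc a b t -> inflection_point a b nu t <-> D p t = 0 /\ D q t = 0.
Proof.
  intros Ht. pose proof (legendre_unit t Ht) as U. pose proof (legendre_unit_deriv t Ht) as V.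
  change (inflection_point a b nu t) with (D p t * - q t + D q t * p t = 0).
  split; [| intros [-> ->]; ring].
  intros E. destruct (orthogonal_unit_coordinates _ _ _ _ U V) as [Ep Eq].
  rewrite E in Ep, Eq. split; lra.
Qed.

(** * Convexity forces the third-order term to vanish *)

(** [nonneg_third_deriv] is applied to c times the height of gamma above its tangent line at t; u
    only tells on which side of t the interval continues. *)
Lemma convex_third_contact_side (c t u : R) :
  (forall s, Icc a b s -> 0 <= c * dot (vsub (gamma s) (gamma t)) (nu t)) ->
  Icc a b t -> Icc a b u -> u <> t -> singular_or_inflection t ->
  0 <= - (c * third_contact t) * (u - t).
Proof.
  intros Hc Ht Hu Hut Hsi.
  (* This product is minus gamma'' . nu, so its vanishing makes the second derivative of the height
     zero at t. *)
  assert (Hz : D x t * D p t + D y t * D q t = 0).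
  { destruct Hsi as [H | H]; [apply singular_iff in H | apply inflection_iff in H; trivial];
      destruct H as [-> ->]; ring. }
  assert (Hlin : forall f1 f2 s l1 l2, deriv_at a b f1 s l1 -> deriv_at a b f2 s l2 ->
    deriv_at a b (fun r => c * (f1 r * p t + f2 r * q t)) s (c * (l1 * p t + l2 * q t))).
  { intros f1 f2 s l1 l2 H1 H2.
    pose proof (deriv_at_mult _ _ _ _ _ _ _ (deriv_at_const a b c s)
      (deriv_at_plus _ _ _ _ _ _ _
        (deriv_at_mult _ _ _ _ _ _ _ H1 (deriv_at_const a b (p t) s))
        (deriv_at_mult _ _ _ _ _ _ _ H2 (deriv_at_const a b (q t) s)))) as H.
    refine (eq_ind _ (deriv_at a b _ s) H _ _). ring. }
  unfold third_contact.
  replace (- (c * _)) with (c * (D (D (D x)) t * p t + D (D (D y)) t * q t))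
    by (rewrite legendre_tangency_deriv2; trivial; ring).
  apply (nonneg_third_deriv a b
    (fun s => c * ((x s + - x t) * p t + (y s + - y t) * q t))
    (fun s => c * (D x s * p t + D y s * q t))
    (fun s => c * (D (D x) s * p t + D (D y) s * q t))); trivial.
  - intros s Hs.
    destruct (legendre_deriv_at x s ltac:(tauto) Hs) as [Hx _].
    destruct (legendre_deriv_at y s ltac:(tauto) Hs) as [Hy _].
    pose proof (Hlin _ _ _ _ _
      (deriv_at_plus _ _ _ _ _ _ _ Hx (deriv_at_opp _ _ _ _ _ (deriv_at_const a b (x t) s)))
      (deriv_at_plus _ _ _ _ _ _ _ Hy (deriv_at_opp _ _ _ _ _ (deriv_at_const a b (y t) s)))) as H.
    refine (eq_ind _ (deriv_at a b _ s) H _ _). ring.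
  - intros s Hs.
    destruct (legendre_deriv_at x s ltac:(tauto) Hs) as (_ & Hx & _).
    destruct (legendre_deriv_at y s ltac:(tauto) Hs) as (_ & Hy & _).
    exact (Hlin _ _ _ _ _ Hx Hy).
  - destruct (legendre_deriv_at x t ltac:(tauto) Ht) as (_ & _ & Hx).
    destruct (legendre_deriv_at y t ltac:(tauto) Ht) as (_ & _ & Hy).
    exact (Hlin _ _ _ _ _ Hx Hy).
  - ring.
  - rewrite legendre_tangency by trivial. ring.
  - pose proof (legendre_tangency_deriv t Ht) as H. rewrite Hz in H.
    replace (D (D x) t * p t + D (D y) t * q t) with 0 by lra. ring.
Qed.

Lemma convex_sign :
  convex a b gamma nu ->
  exists c, c <> 0 /\ forall s t, Icc a b s -> Icc a b t ->
    0 <= c * dot (vsub (gamma s) (gamma t)) (nu t).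
Proof.
  intros [H | H]; [exists 1 | exists (-1)]; (split; [lra |]);
    intros s t Hs Ht; specialize (H s t Hs Ht); lra.
Qed.

(** At a singular base point gamma' = 0 removes nu'' and leaves gamma''; at an inflection point nu'
    = 0 removes gamma'' and leaves nu''. In each case the base point hypothesis matches the
    surviving second derivative. *)
Lemma third_contact_closed :
  C1_closed a b gamma nu -> no_corner_at_base_point a b gamma nu ->
  singular_or_inflection a \/ singular_or_inflection b ->
  (singular_or_inflection a /\ singular_or_inflection b) /\
  third_contact a = third_contact b.
Proof.
  intros Hcl [Hs Hi] Hab.
  assert (Ha : Icc a b a) by (unfold Icc; lra).
  assert (Hb : Icc a b b) by (unfold Icc; lra).
  destruct (Hcl 1%nat (le_n 1)) as [Eg En].
  change ((D x a, D y a) = (D x b, D y b)) in Eg.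
  change ((D p a, D q a) = (D p b, D q b)) in En.
  injection Eg as Ex Ey. injection En as Ep Eq.
  assert (Esi : singular_or_inflection a <-> singular_or_inflection b).
  { unfold singular_or_inflection.
    rewrite !singular_iff, !inflection_iff, Ex, Ey, Ep, Eq by trivial. reflexivity. }
  assert (Hsa : singular_or_inflection a) by tauto.
  split; [tauto |]. unfold third_contact.
  destruct Hsa as [H | H].
  - specialize (Hs H). apply singular_iff in H.
    change ((D (D x) a, D (D y) a) = (D (D x) b, D (D y) b)) in Hs.
    injection Hs as Ex2 Ey2. destruct H as [Hx Hy].
    rewrite <- Ex, <- Ey, <- Ep, <- Eq, <- Ex2, <- Ey2, Hx, Hy. ring.
  - specialize (Hi H). apply inflection_iff in H; trivial.
    change ((D (D p) a, D (D q) a) = (D (D p) b, D (D q) b)) in Hi.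
    injection Hi as Ep2 Eq2. destruct H as [Hp Hq].
    rewrite <- Ex, <- Ey, <- Ep, <- Eq, <- Ep2, <- Eq2, Hp, Hq. ring.
Qed.

Lemma convex_third_contact (t : R) :
  C1_closed a b gamma nu -> no_corner_at_base_point a b gamma nu ->
  convex a b gamma nu -> Icc a b t -> singular_or_inflection t ->
  third_contact t = 0.
Proof.
  intros Hcl Hbase Hconv Ht Hsi.
  destruct (convex_sign Hconv) as [c [Hc Hpos]].
  assert (Ha : Icc a b a) by (unfold Icc; lra).
  assert (Hb : Icc a b b) by (unfold Icc; lra).
  enough (c * third_contact t = 0) as H
    by (apply Rmult_integral in H; destruct H; [contradiction | trivial]).
  assert (Hside : forall r u, Icc a b r -> Icc a b u -> u <> r ->
            singular_or_inflection r -> 0 <= - (c * third_contact r) * (u - r)).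
  { intros r u Hr Hu Hur Hsr. apply convex_third_contact_side; auto. }
  assert (Hends : t = a \/ t = b -> c * third_contact t = 0).
  { intros E.
    destruct (third_contact_closed Hcl Hbase) as [[Sa Sb] Eab].
    { destruct E as [E | E]; rewrite E in Hsi; tauto. }
    (* Each end has one side only, but b - a and a - b have opposite signs and the two values of
       [third_contact] agree. *)
    pose proof (Hside a b Ha Hb ltac:(lra) Sa) as H1.
    pose proof (Hside b a Hb Ha ltac:(lra) Sb) as H2.
    assert (c * third_contact b = 0) by (rewrite Eab in H1; nra).
    destruct E as [E | E]; rewrite E; congruence. }
  destruct (Req_dec t a) as [E | Ea]; [auto |].
  destruct (Req_dec t b) as [E | Eb]; [auto |].
  (* At an interior point both ends serve as u, giving both inequalities. *)
  pose proof (Hside t a Ht Ha ltac:(lra) Hsi) as H1.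
  pose proof (Hside t b Ht Hb ltac:(lra) Hsi) as H2.
  unfold Icc in Ht. nra.
Qed.

(** * From contact to vertices *)

Lemma singular_not_inflection (t : R) :
  legendre_immersion a b gamma nu -> Icc a b t ->
  singular_point a b gamma t -> ~ inflection_point a b nu t.
Proof.
  intros [_ Himm] Ht Hs Hi. apply (Himm t Ht). split; [exact Hs |].
  apply inflection_iff in Hi; trivial. destruct Hi as [Ep Eq].
  exact (f_equal2 pair Ep Eq).
Qed.

Lemma ell_beta_neq_0 (t : R) :
  legendre_immersion a b gamma nu -> Icc a b t ->
  ~ (ell a b nu t = 0 /\ beta a b gamma nu t = 0).
Proof.
  intros Himm Ht [El Eb].
  apply (singular_not_inflection t Himm Ht); [| exact El].
  apply singular_iff.
  change (D x t * - q t + D y t * p t = 0) in Eb.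
  pose proof (legendre_unit t Ht) as U. pose proof (legendre_tangency t Ht) as V.
  destruct (orthogonal_unit_coordinates _ _ _ _ U V) as [Ex Ey].
  rewrite Eb in Ex, Ey. split; lra.
Qed.

(** With [B] = beta and [L] = ell, the pair (-B, L) turns the vertex expression into B L' - B' L.
    This is -1/2 times [third_contact] at a singular point and equals [third_contact] at an
    inflection point. *)
Lemma vertex_of_third_contact (t : R) :
  legendre_immersion a b gamma nu -> Icc a b t -> singular_or_inflection t ->
  third_contact t = 0 -> vertex a b gamma nu t.
Proof.
  intros Himm Ht Hsi Hc.
  destruct legendre_smooth_coordinates as (Sx & Sy & Sp & Sq).
  pose (B := fun s => D x s * - q s + D y s * p s).
  pose (L := fun s => D p s * - q s + D q s * p s).
  assert (SB : smooth a b B).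
  { apply smooth_plus; trivial; apply smooth_mult; trivial;
      [apply smooth_deriv | apply smooth_opp | apply smooth_deriv]; trivial. }
  assert (SL : smooth a b L).
  { apply smooth_plus; trivial; apply smooth_mult; trivial;
      [apply smooth_deriv | apply smooth_opp | apply smooth_deriv]; trivial. }
  exists (fun s => - B s), L.
  split; [now apply smooth_opp |]. split; [exact SL |]. split; [| split].
  - intros s Hs E. injection E as E1 E2.
    apply (ell_beta_neq_0 s Himm Hs). split; [exact E2 |].
    change (B s = 0). lra.
  - intros s Hs. change (- B s * L s + L s * B s = 0). ring.
  - destruct (legendre_deriv_at x t ltac:(tauto) Ht) as (_ & Hx & _).
    destruct (legendre_deriv_at y t ltac:(tauto) Ht) as (_ & Hy & _).
    destruct (legendre_deriv_at p t ltac:(tauto) Ht) as (Hp & Hp1 & _).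
    destruct (legendre_deriv_at q t ltac:(tauto) Ht) as (Hq & Hq1 & _).
    assert (HB := deriv_at_plus _ _ _ _ _ _ _
      (deriv_at_mult _ _ _ _ _ _ _ Hx (deriv_at_opp _ _ _ _ _ Hq))
      (deriv_at_mult _ _ _ _ _ _ _ Hy Hp)).
    assert (HL := deriv_at_plus _ _ _ _ _ _ _
      (deriv_at_mult _ _ _ _ _ _ _ Hp1 (deriv_at_opp _ _ _ _ _ Hq))
      (deriv_at_mult _ _ _ _ _ _ _ Hq1 Hp)).
    rewrite (deriv_eq a b (fun s => - B s) t _ hab Ht (deriv_at_opp _ _ _ _ _ HB)).
    rewrite (deriv_eq a b L t _ hab Ht HL).
    pose proof (legendre_unit t Ht) as U.
    unfold third_contact in Hc. unfold B, L.
    destruct Hsi as [H | H].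
    + apply singular_iff in H. destruct H as [Ex Ey]. rewrite Ex, Ey in *.
      pose proof (legendre_unit_deriv t Ht) as V.
      destruct (orthogonal_unit_coordinates _ _ _ _ U V) as [Ep Eq].
      set (l := D p t * - q t + D q t * p t) in *.
      (* Grouped so that ell mu = nu' appears; the result is -gamma'' . nu'. *)
      transitivity (- (D (D x) t * (l * - q t) + D (D y) t * (l * p t))); [ring |].
      rewrite Ep, Eq. lra.
    + apply inflection_iff in H; trivial. destruct H as [Ep Eq]. rewrite Ep, Eq in *.
      pose proof (legendre_tangency t Ht) as V.
      destruct (orthogonal_unit_coordinates _ _ _ _ U V) as [Ex Ey].
      set (k := D x t * - q t + D y t * p t) in *.
      (* Grouped so that beta mu = gamma' appears; the result is gamma' . nu''. *)
      transitivity ((k * - q t) * D (D p) t + (k * p t) * D (D q) t); [ring |].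
      rewrite Ex, Ey. lra.
Qed.

End Legendre.

(** * Counting the vertices *)

Lemma singular_same_point (a b : R) (gamma nu : R -> R2) (s t : R) :
  C1_closed a b gamma nu -> same_point a b s t ->
  singular_point a b gamma s -> singular_point a b gamma t.
Proof.
  intros Hcl Hst. destruct (Hcl 1%nat (le_n 1)) as [E _].
  change (vderiv a b gamma a = vderiv a b gamma b) in E.
  unfold singular_point.
  destruct Hst as [-> | [[-> ->] | [-> ->]]]; congruence.
Qed.

Theorem theorem4p12 (a b : R) (gamma nu : R -> R2)
  (hab : a < b)
  (himm : legendre_immersion a b gamma nu)
  (hclosed : C1_closed a b gamma nu)
  (hbase : no_corner_at_base_point a b gamma nu)
  (hsimple : simple_closed a b gamma)
  (hconvex : convex a b gamma nu)
  (hsing : at_least 2 a b (singular_point a b gamma))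
  (hinfl : at_least 2 a b (inflection_point a b nu)) :
  at_least 4 a b (vertex a b gamma nu).
Proof.
  destruct hsing as [p [Hp Dp]], hinfl as [q [Hq Dq]].
  assert (Hleg := proj1 himm).
  assert (Hvert : forall t, Icc a b t ->
            singular_or_inflection a b gamma nu t -> vertex a b gamma nu t).
  { intros t Ht Hsi. apply vertex_of_third_contact; trivial.
    now apply convex_third_contact. }
  (* If the two points coincided on the closed curve, singularity would carry over to q j, which is
     an inflection point. *)
  assert (Dpq : forall i j, (i < 2)%nat -> (j < 2)%nat -> ~ same_point a b (p i) (q j)).
  { intros i j Hi Hj E. destruct (Hp i Hi) as [_ Hs]. destruct (Hq j Hj) as [Hqj Hinf].
    apply (singular_not_inflection a b gamma nu hab Hleg (q j)); trivial.
    exact (singular_same_point a b gamma nu _ _ hclosed E Hs). }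
  (* Indices 0 and 1 list the singular points, 2 and 3 the inflection points. *)
  exists (fun i => if (i <? 2)%nat then p i else q (i - 2)%nat). split.
  - intros i Hi. destruct (Nat.ltb_spec i 2) as [L | L].
    + destruct (Hp i L) as [Ht Hs]. split; trivial. apply Hvert; [| left]; trivial.
    + destruct (Hq (i - 2)%nat ltac:(lia)) as [Ht Hs]. split; trivial.
      apply Hvert; [| right]; trivial.
  - intros i j Hij Hj.
    destruct (Nat.ltb_spec i 2), (Nat.ltb_spec j 2).
    + now apply Dp.
    + apply Dpq; lia.
    + lia.
    + apply Dq; lia.
Qed.
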